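(* Let $G=(V,E)$ be a finite simple undirected graph with $n:=|V|$ vertices, and let $N:=|AccMet(G)|$. Then there is an algorithm which, given $G$, outputs every member of $AccMet(G)$ exactly once and runs in time $O(N^2 n^3)$ (i.e. $AccMet(G)$ can be enumerated in output-polynomial time $O(N^2n^3)$).
   Context: For $X\subseteq V$ and $s,t\in X$, let $dist_X(s,t)$ be the length (number of edges) of a shortest $s$–$t$ path all of whose vertices lie in $X$ (and $\infty$ if no such path exists); $dist_V$ is the usual graph distance in $G$. A set $Y\subseteq V$ is called metric if $dist_Y(s,t)=dist_V(s,t)$ for all $s,t\in Y$, i.e. for every pair of distinct $s,t\in Y$ at least one shortest $s$–$t$ path of $G$ has all its vertices in $Y$. A metric set $X\subseteq V$ is called accessible if there is a chain of metric sets $\emptyset\subset Y_1\subset Y_2\subset\cdots\subset Y_k=X$ with $|Y_i|=i$ for all $1\le i\le k$. $AccMet(G)$ denotes the family of all accessible metric subsets of $V$. *)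

(* Defs.v *)
From mathcomp Require Import all_boot.

Set Implicit Arguments.
Unset Strict Implicit.
Unset Printing Implicit Defensive.

(** * Accessible metric sets of a graph *)

Section Metric.
Variables (V : finType) (e : rel V).

(* There is an s-t path with exactly k edges and all vertices in X. *)
Definition has_path (X : {set V}) (s t : V) (k : nat) : bool :=
  [exists p : k.-tuple V,
    [&& path e s p, last s p == t, uniq (s :: p) & all (mem X) (s :: p)]].

(* [None] stands for infinity. The vertices of a path are distinct, so a path
   has fewer than #|V| edges and the search over k < #|V| is exhaustive. *)
Definition dist (X : {set V}) (s t : V) : option nat :=
  ohead [seq k <- iota 0 #|V| | has_path X s t k].

Definition metric (Y : {set V}) : bool :=
  [forall s in Y, forall t in Y, dist Y s t == dist [set: V] s t].

(* c is the chain Y_1, ..., Y_k; the condition |Y_i| = i forces k = #|X|.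
   The empty set is accessible, through the chain with k = 0. *)
Definition accessible (X : {set V}) : bool :=
  metric X &&
  [exists c : #|X|.-tuple {set V},
    [&& all metric c,
        path (fun A B : {set V} => A \proper B) set0 c,
        last set0 c == X &
        [forall i, #|tnth c i| == i.+1]]].

Definition AccMet : {set {set V}} := [set X | accessible X].

End Metric.

(** * Random access machine

    A structured form of the word RAM: finitely many registers are mentioned by
    a program, the memory is an array of words with indirect addressing, and
    every elementary operation has unit cost. All words are smaller than the
    parameter W; a computation that produces a larger number is stuck. Without
    that restriction, unit-cost arithmetic would be unrealistically strong. *)

Inductive binop := OpAdd | OpSub | OpMul | OpEq | OpLt.

Definition op_sem (o : binop) (x y : nat) : nat :=
  match o with
  | OpAdd => x + y
  | OpSub => x - y
  | OpMul => x * y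
  | OpEq => x == y
  | OpLt => x < y
  end.

Inductive expr :=
  | Const of nat
  | Reg of nat
  | Mem of expr
  | Op of binop & expr & expr.

Inductive cmd :=
  | Skip
  | Assign of nat & expr
  | Store of expr & expr
  | Print of expr
  | Seq of cmd & cmd
  | If of expr & cmd & cmd
  | While of expr & cmd.

Record state := State {
  regs : nat -> nat;
  memory : nat -> nat;
  output : seq nat
}.

Definition upd (f : nat -> nat) (a x : nat) : nat -> nat :=
  fun b => if b == a then x else f b.

Definition set_reg (st : state) (r x : nat) : state :=
  State (upd (regs st) r x) (memory st) (output st).

Definition set_mem (st : state) (a x : nat) : state :=
  State (regs st) (upd (memory st) a x) (output st).

Definition emit (st : state) (x : nat) : state :=
  State (regs st) (memory st) (rcons (output st) x).

Definition word (W x : nat) : option nat := if x < W then Some x else None.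

Fixpoint eval (W : nat) (st : state) (a : expr) : option nat :=
  match a with
  | Const k => word W k
  | Reg r => word W (regs st r)
  | Mem b => obind (fun x => word W (memory st x)) (eval W st b)
  | Op o b1 b2 =>
      obind (fun x => obind (fun y => word W (op_sem o x y)) (eval W st b2))
            (eval W st b1)
  end.

Fixpoint expr_cost (a : expr) : nat :=
  match a with
  | Const _ => 1
  | Reg _ => 1
  | Mem b => (expr_cost b).+1
  | Op _ b1 b2 => (expr_cost b1 + expr_cost b2).+1
  end.

(* exec W p st t st' : with words below W, the program p started in st halts
   in st' after t steps. *)
Inductive exec (W : nat) : cmd -> state -> nat -> state -> Prop :=
  | exec_Skip st : exec W Skip st 1 st
  | exec_Assign st r a x :
      eval W st a = Some x ->
      exec W (Assign r a) st (expr_cost a).+1 (set_reg st r x)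
  | exec_Store st a b x y :
      eval W st a = Some x -> eval W st b = Some y ->
      exec W (Store a b) st (expr_cost a + expr_cost b).+1 (set_mem st x y)
  | exec_Print st a x :
      eval W st a = Some x ->
      exec W (Print a) st (expr_cost a).+1 (emit st x)
  | exec_Seq p q st st1 st2 t1 t2 :
      exec W p st t1 st1 -> exec W q st1 t2 st2 ->
      exec W (Seq p q) st (t1 + t2) st2
  | exec_If a p q st st' t x :
      eval W st a = Some x ->
      exec W (if x != 0 then p else q) st t st' ->
      exec W (If a p q) st (expr_cost a + t).+1 st'
  | exec_While_false a p st :
      eval W st a = Some 0 ->
      exec W (While a p) st (expr_cost a).+1 st
  | exec_While_true a p st st1 st2 t1 t2 x :
      eval W st a = Some x.+1 ->
      exec W p st t1 st1 -> exec W (While a p) st1 t2 st2 ->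
      exec W (While a p) st (expr_cost a + t1 + t2).+1 st2.

Lemma exec_det W p st t1 st1 t2 st2 :
  exec W p st t1 st1 -> exec W p st t2 st2 -> t1 = t2 /\ st1 = st2.
Proof.
move=> H; elim: H t2 st2 => {p st t1 st1}.
- by move=> st t2 st2 H; inversion H.
- by move=> st r a x E t2 st2 H; inversion H; subst; split; congruence.
- by move=> st a b x y E F t2 st2 H; inversion H; subst; split; congruence.
- by move=> st a x E t2 st2 H; inversion H; subst; split; congruence.
- move=> p q st st1 st2 t1 t2 _ IH1 _ IH2 t3 st3 H; inversion H; subst.
  have [] := IH1 _ _ ltac:(eassumption) => *; subst.
  by have [] := IH2 _ _ ltac:(eassumption) => *; subst.
- move=> a p q st st' t x E _ IH t3 st3 H; inversion H; subst.
  match goal with F : eval W st a = Some ?y |- _ =>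
    have ? : y = x by congruence end; subst.
  by have [] := IH _ _ ltac:(eassumption) => *; subst.
- by move=> a p st E t3 st3 H; inversion H; subst; split; congruence.
- move=> a p st st1 st2 t1 t2 x E _ IH1 _ IH2 t3 st3 H; inversion H; subst.
    by congruence.
  have [] := IH1 _ _ ltac:(eassumption) => *; subst.
  by have [] := IH2 _ _ ltac:(eassumption) => *; subst.
Qed.

(** * Input and output conventions

    Vertices are numbered by their position in [enum V]. The memory initially
    holds #|V| followed by the adjacency matrix, row by row, then zeros. *)

Definition input_of (V : finType) (e : rel V) : seq nat :=
  #|V| :: [seq nat_of_bool (e u v) | u <- enum V, v <- enum V].

Definition init_state (V : finType) (e : rel V) : state :=
  State (fun _ => 0) (nth 0 (input_of e)) [::].

(* A vertex is written as its number plus one; 0 terminates each set. *)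
Definition write_set (V : finType) (X : {set V}) : seq nat :=
  rcons [seq (nat_of_ord (enum_rank v)).+1 | v <- enum X] 0.

Definition write_sets (V : finType) (s : seq {set V}) : seq nat :=
  flatten [seq write_set X | X <- s].

(* Main.v *)
Require Import Defs.
From mathcomp Require Import all_boot zify.

Set Implicit Arguments.
Unset Strict Implicit.
Unset Printing Implicit Defensive.

(** A set [X] is metric iff for all [s], [t] in [X] at finite positive distance
    some neighbour of [s] in [X] is closer to [t] by one; with a table of the
    distances of the graph this is tested in time O(n^3). Every nonempty
    accessible set arises from a smaller one by adding a vertex, so a
    breadth-first search from the empty set, which keeps every metric extension
    [v |: Y] of a listed set [Y] that is not yet listed, lists exactly the
    accessible sets. There are at most [N * n] extensions and each costs
    O(n^3 + N n). All singletons are accessible, so [n < N] and the total is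
    O(N^2 n^3); the distance table costs O(n^4), which is also absorbed. *)

(** * Distances and accessible sets *)

(** A computation that exceeds [W] is stuck, so correctness, running time and the size of all
    numbers have to be proved together. The size depends on the mathematics: at every moment the
    search holds distinct accessible sets only, so it occupies at most [N] rows besides the two
    tables and every address is quadratic in [n + N]. Duplicates are found by comparing rows one
    after the other. This needs no cleverer dictionary: [N n] candidates cost [N^2 n^2] in
    comparisons, while the metric tests cost [N n^4], and only there is a factor [n] traded for [N].
    The tests are loops nested up to three deep. Instead of one loop invariant per quantifier, they
    are written as bounded formulas, and a single induction on formulas shows that the compiled code
    computes their truth value, keeps the registers it reads and respects an explicit time bound.
    What remains per test is to evaluate atomic expressions. *)

Lemma ohead_filter_iota (P : pred nat) m n j :
  P j -> m <= j < m + n ->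
  exists2 d, d <= j & ohead [seq k <- iota m n | P k] = Some d.
Proof.
move=> Pj; elim: n m => [|n IHn] m jmn; first by lia.
rewrite /=; case: ifPn => [Pm|nPm]; first by exists m => //; lia.
apply: IHn; have : m != j by apply: contraNneq nPm => ->.
by lia.
Qed.

Section Distance.
Variables (V : finType) (e : rel V).
Implicit Types (X Y : {set V}) (s t u v w : V).

(** Without the [uniq] condition of [has_path] an edge can be put in front freely. Shortening turns
    a walk back into a path that is no longer, so distances are unaffected. *)
Fixpoint walk X k s t : bool :=
  if k is k'.+1 then (s \in X) && [exists w, e s w && walk X k' w t]
  else (s == t) && (s \in X).

Lemma walkP X k s t :
  reflect (exists p, [/\ size p = k, path e s p, last s p = t
                       & all (mem X) (s :: p)])
          (walk X k s t).
Proof.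
apply: (iffP idP) => [|[p [<- + + +]]].
  elim: k s => [|k IHk] s /=.
    by case/andP=> /eqP<- sX; exists [::]; rewrite /= sX.
  case/andP=> sX /existsP[w /andP[esw /IHk[p [sp pp lp ap]]]].
  by exists (w :: p) => /=; rewrite esw sX sp.
elim: p s => [|w p IHp] s /=; first by move=> _ <- /andP[-> _]; rewrite eqxx.
case/andP=> esw pp lp /andP[-> ap] /=.
by apply/existsP; exists w; rewrite esw IHp.
Qed.

Lemma has_path_walk X k s t : has_path e X s t k -> walk X k s t.
Proof.
case/existsP=> p /and4P[pp /eqP lp _ ap].
by apply/walkP; exists p; rewrite size_tuple.
Qed.

Lemma has_path_lt X k s t : has_path e X s t k -> k < #|V|.
Proof.
case/existsP=> p /and4P[_ _ /card_uniqP pu _].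
by have := max_card (mem (s :: p)); rewrite pu /= size_tuple.
Qed.

Lemma walk_has_path X k s t :
  walk X k s t -> exists2 j, j <= k & has_path e X s t j.
Proof.
case/walkP=> p [<- pp <- /andP[sX ap]].
case/shortenP: pp => p' pp' up' sub.
exists (size p'); first exact: uniq_leq_size (andP up').2 sub.
apply/existsP; exists (in_tuple p'); rewrite pp' eqxx up' /=.
by apply/andP; split=> //; apply/allP=> x /sub /(allP ap).
Qed.

Lemma dist_walk X s t d : dist e X s t = Some d -> walk X d s t.
Proof.
rewrite /dist; case E: [seq _ <- _ | _] => [|k l] //= [<-].
have: k \in k :: l by exact: mem_head.
by rewrite -E mem_filter => /andP[/has_path_walk].
Qed.

Lemma dist_lt X s t d : dist e X s t = Some d -> d < #|V|.
Proof.
rewrite /dist; case E: [seq _ <- _ | _] => [|k l] //= [<-].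
have: k \in k :: l by exact: mem_head.
by rewrite -E mem_filter => /andP[/has_path_lt].
Qed.

Lemma walk_dist X s t k :
  walk X k s t -> exists2 d, d <= k & dist e X s t = Some d.
Proof.
case/walk_has_path=> j jk pj.
have [|d dj dE] := ohead_filter_iota (m := 0) (n := #|V|) pj.
  by rewrite (has_path_lt pj).
by exists d => //; exact: leq_trans jk.
Qed.

Lemma walk_sub X Y k s t : X \subset Y -> walk X k s t -> walk Y k s t.
Proof.
move=> /subsetP XY; elim: k s => [|k IHk] s /=.
  by case/andP=> -> /XY.
case/andP=> /XY-> /existsP[w /andP[esw /IHk H]].
by apply/existsP; exists w; rewrite esw.
Qed.

(** Distance as a machine word: shifted by one, with 0 for infinity, so that zeroed memory is the
    table in which nothing has been reached. *)
Definition dcode s t : nat := if dist e setT s t is Some d then d.+1 else 0.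

Lemma dcode_le s t : dcode s t <= #|V|.
Proof. by rewrite /dcode; case E: dist => [d|//]; exact: dist_lt E. Qed.

Lemma dcode_walk s t d : dcode s t = d.+1 -> walk setT d s t.
Proof. by rewrite /dcode; case E: dist => [k|//] [<-]; exact: dist_walk. Qed.

Lemma walk_dcode s t k : walk setT k s t -> 0 < dcode s t <= k.+1.
Proof. by rewrite /dcode => /walk_dist[d dk ->]. Qed.

Lemma dcode_refl s : dcode s s = 1.
Proof.
have := @walk_dcode s s 0; rewrite /= eqxx inE => /(_ isT).
by lia.
Qed.

Lemma dcode_eq1 s t : (dcode s t == 1) = (s == t).
Proof.
apply/eqP/eqP => [/dcode_walk /andP[/eqP//]|->]; exact: dcode_refl.
Qed.

Lemma dcode_edge s w t : e s w -> 0 < dcode w t -> dcode s t <= (dcode w t).+1.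
Proof.
move=> esw; case E: (dcode w t) => [//|d] _.
have /walk_dcode/andP[//] : walk setT d.+1 s t.
by rewrite /= inE; apply/existsP; exists w; rewrite esw dcode_walk.
Qed.

Lemma dcode_step s t d :
  dcode s t = d.+2 -> exists2 w, e s w & dcode w t = d.+1.
Proof.
move=> E; have /= := dcode_walk E.
case/andP=> _ /existsP[w /andP[esw /walk_dcode/andP[w0 wd]]].
by exists w => //; have := dcode_edge esw w0; lia.
Qed.

(** * Truncated distance tables *)

(** The table after some rounds: codes above the bound [m] still read 0, like infinity. *)
Definition trunc (m x : nat) : nat := if x <= m then x else 0.

Lemma trunc_le m x : trunc m x <= x.
Proof. by rewrite /trunc; case: ifP. Qed.

(* The table of truncated distances may be updated in place from bound [k.+1] to
   bound [k.+2], because the test only depends on the entries equal to [k.+1]. *)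
Lemma trunc_dcode_step k s t :
  trunc k.+2 (dcode s t) =
    if (trunc k.+1 (dcode s t) == 0) && [exists w, e s w && (dcode w t == k.+1)]
    then k.+2 else trunc k.+1 (dcode s t).
Proof.
rewrite /trunc; case: (leqP (dcode s t) k.+1) => H.
  rewrite ltnW //; case: eqP => //= d0.
  case: existsP => // -[w /andP[esw /eqP dw]].
  have /andP[] : 0 < dcode s t <= k.+2.
    apply: walk_dcode; rewrite /= inE; apply/existsP; exists w.
    by rewrite esw (dcode_walk dw).
  by rewrite d0.
rewrite eqxx /=; case: existsP => [[w /andP[esw /eqP dw]]|nw].
  by have := dcode_edge (t := t) esw; rewrite dw => /(_ isT) H2; rewrite H2; lia.
case: leqP => // H2; case: nw.
have /dcode_step[w esw dw] : dcode s t = k.+2 by lia.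
by exists w; rewrite esw dw /=.
Qed.

(** * The local test for metric sets *)

Definition locally_metric X : bool :=
  [forall s in X, forall t in X, (1 < dcode s t) ==>
    [exists w, [&& w \in X, e s w & (dcode w t).+1 == dcode s t]]].

(** If [X] is metric, [w] is the second vertex of a shortest path inside [X]. Conversely, induction
    on the distance chains the single steps into a walk inside [X] of the right length; no shorter
    one exists, since walks in [X] are walks in the graph, which also settles infinite distances. *)
Lemma metricE X : metric e X = locally_metric X.
Proof.
apply/idP/idP => [/forall_inP mX | /forall_inP lX].
  apply/forall_inP=> s sX; apply/forall_inP=> t tX; apply/implyP.
  case E: (dcode s t) => [|[|d]] // _.
  have /forall_inP/(_ t tX)/eqP dX := mX s sX.
  have : dist e X s t = Some d.+1.
    by rewrite dX; move: E; rewrite /dcode; case: dist => // ? [->].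
  move/dist_walk => /= /andP[_ /existsP[w /andP[esw ww]]].
  have wX : w \in X by case: (d) ww => [|?] /andP[] // /eqP-> _.
  apply/existsP; exists w; rewrite wX esw /=.
  have /andP[w0 wd] := walk_dcode (walk_sub (subsetT X) ww).
  by have := dcode_edge esw w0; rewrite E; lia.
have walkX d s t : s \in X -> t \in X -> dcode s t = d.+1 -> walk X d s t.
  elim: d s => [|d IHd] s sX tX E.
    by rewrite /= sX -dcode_eq1 E.
  rewrite /= sX; have /forall_inP/(_ t tX) := lX s sX.
  rewrite E => /existsP[w /and3P[wX esw /eqP[dw]]].
  by apply/existsP; exists w; rewrite esw IHd.
apply/forall_inP=> s sX; apply/forall_inP=> t tX.
case E: (dist e setT s t) => [d|].
  have /walk_dist[d' d'd E'] : walk X d s t by apply: walkX; rewrite // /dcode E.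
  have := walk_dcode (walk_sub (subsetT X) (dist_walk E')).
  by rewrite E' /dcode E => H; apply/eqP; congr Some; lia.
case E': (dist e X s t) => [d|//].
by have := walk_dcode (walk_sub (subsetT X) (dist_walk E')); rewrite /dcode E.
Qed.

Lemma metric0 : metric e set0.
Proof. by rewrite metricE; apply/forall_inP=> s; rewrite inE. Qed.

Lemma metric1 v : metric e [set v].
Proof.
rewrite metricE; apply/forall_inP=> s /set1P->; apply/forall_inP=> t /set1P->.
by rewrite dcode_refl.
Qed.

(** * Chains of metric sets *)

(** With a sequence in place of a tuple indexed by [#|X|], chains can be extended and cut without
    casts. *)
Lemma accessibleP X :
  reflect (metric e X /\ exists c : seq {set V},
             [/\ size c = #|X|, all (metric e) c,
                 path (fun A B : {set V} => A \proper B) set0 c, last set0 c = X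
               & forall i, i < size c -> #|nth set0 c i| = i.+1])
          (accessible e X).
Proof.
apply: (iffP andP) => -[mX cX]; split=> //.
  case/existsP: cX => c /and4P[ac pc /eqP lc /forallP nc]; exists c; split=> //.
    by rewrite size_tuple.
  rewrite size_tuple => i ic; have /eqP := nc (Ordinal ic).
  by rewrite (tnth_nth set0).
case: cX => c [sc ac pc lc nc]; apply/existsP.
exists (tcast sc (in_tuple c)); rewrite !val_tcast ac pc lc eqxx /=.
apply/forallP=> i; rewrite (tnth_nth set0) val_tcast /= nc //.
by rewrite sc.
Qed.

Lemma accessible_metric X : accessible e X -> metric e X.
Proof. by case/andP. Qed.

Lemma accessible0 : accessible e set0.
Proof.
by apply/accessibleP; split; [exact: metric0 | exists [::]; rewrite cards0].
Qed.

Lemma accessibleU1 X v :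
  accessible e X -> metric e (v |: X) -> accessible e (v |: X).
Proof.
case: (boolP (v \in X)) => [vX|vX].
  by rewrite (setUidPr _) // sub1set.
case/accessibleP=> mX [c [sc ac pc lc nc]] mvX.
apply/accessibleP; split=> //; exists (rcons c (v |: X)).
have cvX : #|v |: X| = #|X|.+1 by rewrite cardsU1 vX.
split.
- by rewrite size_rcons sc cvX.
- by rewrite all_rcons mvX.
- rewrite rcons_path pc lc properEcard subsetUr cvX /=.
  exact: leqnn.
- by rewrite last_rcons.
move=> i; rewrite size_rcons nth_rcons ltnS leq_eqVlt.
case: ltnP => [ic _|ci]; first exact: nc.
by rewrite orbF => /eqP->; rewrite eqxx cvX sc.
Qed.

(** Dropping the last set of a chain for [X] leaves a chain for the set before it, which is properly
    contained in [X] and one element smaller, hence of the form [X :\ v]. *)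
Lemma accessibleD1 X :
  accessible e X -> X != set0 -> exists2 v, v \in X & accessible e (X :\ v).
Proof.
case/accessibleP=> mX [c [sc ac pc lc nc]] X0.
case/lastP: c sc ac pc lc nc => [|c Y].
  by move/esym/eqP; rewrite cards_eq0 (negPf X0).
rewrite size_rcons all_rcons rcons_path last_rcons => sc /andP[_ ac].
case/andP=> pc + YX; rewrite YX => /properP[sub [v vX vY]] nc.
(* If nothing is left of the chain, [last] returns its default [set0], whose size 0 is the right
   one. *)
have cardc : #|last set0 c| = size c.
  case/lastP: c {sc ac pc sub vY} nc => [|c Z] nc; first by rewrite cards0.
  have := nc (size c); rewrite last_rcons size_rcons nth_rcons size_rcons.
  by rewrite leqnSn ltnSn nth_rcons ltnn eqxx => ->.
have eqX : X :\ v = last set0 c.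
  apply/esym/eqP; rewrite eqEcard; apply/andP; split.
    by rewrite subsetD1 sub.
  by rewrite cardc; have := cardsD1 v X; rewrite vX -sc; lia.
exists v => //; rewrite eqX; apply/accessibleP; split.
  by case/lastP: c {sc pc sub vY cardc eqX nc} ac => [|c Z];
    rewrite ?metric0 // last_rcons all_rcons => /andP[].
exists c; split=> // i ic; rewrite -(nc i); last by lia.
by rewrite nth_rcons ic.
Qed.

Lemma accessible1 v : accessible e [set v].
Proof.
have := accessibleU1 (v := v) accessible0; rewrite setU0 => -> //.
exact: metric1.
Qed.

(** The empty set, counted besides the singletons, makes the inequality strict. *)
Lemma card_AccMet_gt : #|V| < #|AccMet e|.
Proof.
have sub : set0 |: [set [set v] | v : V] \subset AccMet e.
  apply/subsetP=> X /setU1P[->|/imsetP[v _ ->]]; rewrite inE.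
    exact: accessible0.
  exact: accessible1.
apply: leq_trans (subset_leq_card sub).
rewrite cardsU1 card_imset; last exact: set1_inj.
suff -> : set0 \notin [set [set v] | v : V] by rewrite add1n.
by apply/imsetP=> -[v _ /setP/(_ v)]; rewrite !inE eqxx.
Qed.

End Distance.

(** * Timed execution *)

Section TimedExecution.
Variable W : nat.
Implicit Types (st : state) (p q : cmd) (a b : expr) (Q : state -> Prop).

(** A total-correctness triple with a time budget; as [T] is only an upper bound, branches of
    different cost can share it. *)
Definition run p st (T : nat) Q : Prop :=
  exists t st', [/\ exec W p st t st', t <= T & Q st'].

Lemma run_weaken p st T T' Q Q' :
  run p st T Q -> T <= T' -> (forall st', Q st' -> Q' st') -> run p st T' Q'.
Proof.
by case=> t [st' [ex tT Qst]] TT' QQ'; exists t, st'; split; [|lia|exact: QQ'].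
Qed.

Lemma run_time p st T T' Q : T <= T' -> run p st T Q -> run p st T' Q.
Proof. by move=> TT' rT; exact: run_weaken rT TT' _. Qed.

Lemma run_skip st T Q : 0 < T -> Q st -> run Skip st T Q.
Proof. by move=> T0 Qst; exists 1, st; split=> //; constructor. Qed.

Lemma run_assign r a st x T Q :
  eval W st a = Some x -> expr_cost a < T -> Q (set_reg st r x) ->
  run (Assign r a) st T Q.
Proof. by move=> ax aT Qst; do 2 eexists; split; [exact: exec_Assign ax| |]. Qed.

Lemma run_store a b st x y T Q :
  eval W st a = Some x -> eval W st b = Some y ->
  expr_cost a + expr_cost b < T -> Q (set_mem st x y) ->
  run (Store a b) st T Q.
Proof.
by move=> ax bY aT Qst; do 2 eexists; split; [exact: exec_Store ax bY| |].
Qed.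

Lemma run_print a st x T Q :
  eval W st a = Some x -> expr_cost a < T -> Q (emit st x) ->
  run (Print a) st T Q.
Proof. by move=> ax aT Qst; do 2 eexists; split; [exact: exec_Print ax| |]. Qed.

Lemma run_seq p q st T1 T2 Q :
  run p st T1 (fun st1 => run q st1 T2 Q) -> run (Seq p q) st (T1 + T2) Q.
Proof.
case=> t1 [st1 [ex1 le1 [t2 [st2 [ex2 le2 Qst]]]]].
by exists (t1 + t2), st2; split; [exact: exec_Seq ex1 ex2|lia|].
Qed.

Lemma run_if a p q st x T Q :
  eval W st a = Some x -> (x != 0 -> run p st T Q) -> (x = 0 -> run q st T Q) ->
  run (If a p q) st (expr_cost a + T).+1 Q.
Proof.
move=> ax rp rq; have [t [st' [ex le Qst]]] : run (if x != 0 then p else q) st T Q.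
  by case: (eqVneq x 0) => /= [/rq|/rp].
by exists (expr_cost a + t).+1, st'; split; [exact: exec_If ax ex|lia|].
Qed.

(* The index [i] of the invariant bounds the number of remaining iterations. *)
Lemma run_while a p T (I : nat -> state -> Prop) Q :
  (forall i st, I i st ->
     eval W st a = Some 0 /\ Q st \/
     exists x j, [/\ i = j.+1, eval W st a = Some x.+1 & run p st T (I j)]) ->
  forall i st, I i st ->
  run (While a p) st (i * (T + expr_cost a).+1 + (expr_cost a).+1) Q.
Proof.
move=> step; elim=> [|i IHi] st /step[[a0 Qst]|[x [j [//]]]].
- by exists (expr_cost a).+1, st; split=> //; exact: exec_While_false.
- by exists (expr_cost a).+1, st; split=> //; [exact: exec_While_false|lia].
case=> <- ax [t1 [st1 [ex1 le1 /IHi[t2 [st2 [ex2 le2 Qst]]]]]].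
exists (expr_cost a + t1 + t2).+1, st2; split=> //.
  exact: exec_While_true ax ex1 ex2.
by rewrite mulSn; lia.
Qed.

Lemma eval_const st k : k < W -> eval W st (Const k) = Some k.
Proof. by rewrite /= /word => ->. Qed.

Lemma eval_reg st r : regs st r < W -> eval W st (Reg r) = Some (regs st r).
Proof. by rewrite /= /word => ->. Qed.

Lemma eval_mem st a x :
  eval W st a = Some x -> memory st x < W ->
  eval W st (Defs.Mem a) = Some (memory st x).
Proof. by move=> /= -> /=; rewrite /word => ->. Qed.

Lemma eval_op st o a b x y :
  eval W st a = Some x -> eval W st b = Some y -> op_sem o x y < W ->
  eval W st (Op o a b) = Some (op_sem o x y).
Proof. by move=> /= -> -> /=; rewrite /word => ->. Qed.

Hypothesis W_gt1 : 1 < W.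

Lemma eval_lt_op st a b x y :
  eval W st a = Some x -> eval W st b = Some y ->
  eval W st (Op OpLt a b) = Some (nat_of_bool (x < y)).
Proof. by move=> ax bY; apply: eval_op => //=; case: ltnP; lia. Qed.

Lemma eval_eq_op st a b x y :
  eval W st a = Some x -> eval W st b = Some y ->
  eval W st (Op OpEq a b) = Some (nat_of_bool (x == y)).
Proof. by move=> ax bY; apply: eval_op => //=; case: eqP; lia. Qed.

Definition For (r : nat) (lo : expr) (h : nat) (body : cmd) : cmd :=
  Seq (Assign r lo)
      (While (Op OpLt (Reg r) (Reg h))
             (Seq body (Assign r (Op OpAdd (Reg r) (Const 1))))).

(** Each round pays 8 beyond the body: 3 for the guard, 1 for the loop, 4 for the increment. The
    final 5 covers the initial assignment and the failing guard. [I i] is required once the counter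
    holds [i], so it has to survive that assignment. *)
Lemma run_for r lo h body st l H T (I : nat -> state -> Prop) Q T' :
  eval W st lo = Some l -> l <= H -> H < W -> regs st h = H -> r != h ->
  I l (set_reg st r l) ->
  (forall i st1, l <= i < H -> regs st1 r = i -> regs st1 h = H -> I i st1 ->
     run body st1 T (fun st2 =>
       [/\ regs st2 r = i, regs st2 h = H & I i.+1 (set_reg st2 r i.+1)])) ->
  (forall st1, I H st1 -> regs st1 r = H -> regs st1 h = H -> Q st1) ->
  expr_cost lo + (H - l) * (T + 8) + 5 <= T' ->
  run (For r lo h body) st T' Q.
Proof.
move=> lol lH HW hH rh I0 step fin TT'.
apply: run_time TT' _.
apply: (@run_weaken _ _ ((expr_cost lo).+1 + ((H - l) * (T + 4 + 3).+1 + 4)) _ Q);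
  [|lia|by []].
apply: run_seq; apply: run_assign lol (ltnSn _) _.
(* [run_while] counts the remaining rounds downwards, whereas [I] follows the counter upwards. *)
pose J i st1 := [/\ i = H - regs st1 r, l <= regs st1 r <= H, regs st1 h = H
                  & I (regs st1 r) st1].
have JP : J (H - l) (set_reg st r l).
  by rewrite /J /= /upd eqxx [h == r]eq_sym (negPf rh) lH leqnn.
apply: (run_while (I := J)) JP => i st1 [iE /andP[lr rH] st1h Ir].
have rW : regs st1 r < W by exact: leq_ltn_trans HW.
have ev := eval_lt_op (eval_reg rW) (@eval_reg st1 h ltac:(by rewrite st1h)).
rewrite ev st1h; case: ltnP => [ltr|leHr]; last first.
  have rE : regs st1 r = H by lia.
  by left; split=> //; apply: fin => //; rewrite -rE.
right; exists 0, (H - (regs st1 r).+1); split=> //; first by lia.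
apply: run_seq; apply: run_weaken (step _ _ _ erefl st1h Ir) _ _ => //.
  by rewrite lr.
move=> st2 [r2 h2 I2].
have r2W : regs st2 r < W by rewrite r2.
apply: run_assign; first apply: eval_op; rewrite ?eval_reg ?eval_const //=.
  by rewrite r2 addn1; lia.
by rewrite r2 addn1 /J /= /upd eqxx [h == r]eq_sym (negPf rh); split=> //; lia.
Qed.

End TimedExecution.

(** * Compilation of bounded formulas *)

(* The bound variable of an [FEx] lives in register [d.+1], where [d] is the
   destination register of the compiled formula; its body is compiled with
   destination [d.+2]. *)
Inductive form :=
  | FE of expr
  | FNot of form
  | FAnd of form & form
  | FEx of expr & nat & form.

Fixpoint compile (d : nat) (f : form) : cmd :=
  match f with
  | FE a => Assign d (Op OpLt (Const 0) a)
  | FNot f => Seq (compile d f) (Assign d (Op OpEq (Reg d) (Const 0)))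
  | FAnd f g => Seq (compile d f) (If (Reg d) (compile d g) Skip)
  | FEx lo h f =>
      Seq (Assign d (Const 0))
          (For d.+1 lo h
             (Seq (compile d.+2 f) (If (Reg d.+2) (Assign d (Const 1)) Skip)))
  end.

Fixpoint expr_in (sc : seq nat) (a : expr) : bool :=
  match a with
  | Const _ => true
  | Reg r => r \in sc
  | Defs.Mem b => expr_in sc b
  | Op _ b c => expr_in sc b && expr_in sc c
  end.

(** [sc] is the scope of readable registers. When all of them lie below [d], the compiled code,
    which writes only from [d] on, cannot disturb what the formula reads. *)
Fixpoint form_in (d : nat) (sc : seq nat) (f : form) : bool :=
  match f with
  | FE a => expr_in sc a
  | FNot f => form_in d sc f
  | FAnd f g => form_in d sc f && form_in d sc g
  | FEx lo h f => [&& expr_in sc lo, h \in sc & form_in d.+2 (d.+1 :: sc) f]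
  end.

Section Formulas.
(* [len h] bounds the length of the ranges with upper end in register [h]. *)
Variables (W : nat) (len : nat -> nat).

(** A relation, because evaluation may get stuck at the word bound. The body of [FEx] must have a
    value on the whole range, since the compiled loop does not stop at a witness. *)
Fixpoint fsem (d : nat) (st : state) (f : form) (b : bool) : Prop :=
  match f with
  | FE a => exists2 x, eval W st a = Some x & b = (0 < x)
  | FNot f => fsem d st f (~~ b)
  | FAnd f g =>
      exists b1 : bool, fsem d st f b1 /\ if b1 then fsem d st g b else b = false
  | FEx lo h f =>
      exists l (P : nat -> bool),
        [/\ eval W st lo = Some l, l <= regs st h < W, regs st h - l <= len h,
            forall w, l <= w < regs st h ->
              fsem d.+2 (set_reg st d.+1 w) f (P w)
          & b <-> exists2 w, l <= w < regs st h & P w]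
  end.

(** Independent of the state, so that it can serve as a budget inside loops. In [FEx], 13 is 8 for a
    round of [For] and 5 for the test of the result of the body. *)
Fixpoint ftime (f : form) : nat :=
  match f with
  | FE a => expr_cost a + 3
  | FNot f => ftime f + 4
  | FAnd f g => ftime f + ftime g + 3
  | FEx lo h f => expr_cost lo + len h * (ftime f + 13) + 7
  end.

Definition same_below (d : nat) (st st' : state) : Prop :=
  [/\ forall r, r < d -> regs st' r = regs st r,
      memory st' = memory st & output st' = output st].

Lemma same_below_trans d d' st1 st2 st3 : d <= d' ->
  same_below d st1 st2 -> same_below d' st2 st3 -> same_below d st1 st3.
Proof.
move=> dd' [r1 m1 o1] [r2 m2 o2]; split; try congruence.
by move=> r rd; rewrite r2 ?r1 //; lia.
Qed.

Lemma eval_same st st' sc a :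
  {in sc, regs st' =1 regs st} -> memory st' = memory st -> expr_in sc a ->
  eval W st' a = eval W st a.
Proof.
move=> rE mE; elim: a => //= [r /rE->//|b IHb /IHb->|o b IHb c IHc].
  by rewrite mE.
by case/andP=> /IHb-> /IHc->.
Qed.

Lemma fsem_same d sc st st' f b :
  {in sc, regs st' =1 regs st} -> memory st' = memory st -> form_in d sc f ->
  fsem d st f b -> fsem d st' f b.
Proof.
elim: f d sc st st' b => [a|f IHf|f IHf g IHg|lo h f IHf] d sc st st' b rE mE /=.
- by move=> /(eval_same rE mE) ->.
- exact: IHf rE mE.
- case/andP=> wf wg [b1 [fb1 gb]]; exists b1; split.
    exact: IHf rE mE wf fb1.
  by case: b1 {fb1} gb => // gb; exact: IHg rE mE wg gb.
case/and3P=> wlo hd wf [l [P [lol lW llen fP Pb]]].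
exists l, P; rewrite (eval_same rE mE wlo) (rE _ hd); split=> // w lw.
apply: IHf (fP w lw); [|exact: mE|exact: wf].
move=> r; rewrite inE /= /upd; case: eqP => //= _; exact: rE.
Qed.

Lemma fsem_bool d st a (b : bool) :
  eval W st a = Some (nat_of_bool b) -> fsem d st (FE a) b.
Proof. by move=> ab; exists b => //; case: b {ab}. Qed.

Lemma fsem_not d st f b : fsem d st f b -> fsem d st (FNot f) (~~ b).
Proof. by rewrite /= negbK. Qed.

Lemma fsem_and d st f g b1 b2 :
  fsem d st f b1 -> fsem d st g b2 -> fsem d st (FAnd f g) (b1 && b2).
Proof. by move=> fb1 gb2; exists b1; split=> //; case: b1 {fb1}. Qed.

Hypothesis W_gt1 : 1 < W.

Lemma run_compile d sc st f b :
  all (fun r => r < d) sc -> form_in d sc f -> fsem d st f b ->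
  run W (compile d f) st (ftime f)
    (fun st' => same_below d st st' /\ regs st' d = b).
Proof.
have W0 : 0 < W by exact: ltnW.
have bW (c : bool) : c < W by case: c.
have ssc d' sc' st1 st2 : all (fun r => r < d') sc' -> same_below d' st1 st2 ->
    {in sc', regs st2 =1 regs st1}.
  by move=> /allP scd [rE _ _] r /scd; exact: rE.
elim: f d sc st b => [a|f IHf|f IHf g IHg|lo h f IHf] d sc st b scd /=.
- move=> _ [x ax ->]; apply: run_assign; first exact: eval_lt_op (eval_const _ _) ax.
    by rewrite /=; lia.
  rewrite /= /upd eqxx; split=> //; split=> //= r rd.
  by rewrite /upd; case: eqP => //; lia.
- move=> wf fb; apply: run_seq; apply: run_weaken (IHf _ _ _ _ scd wf fb) _ _ => //.
  move=> st1 [[r1 m1 o1] d1]; apply: run_assign => //.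
    by apply: eval_eq_op; rewrite ?eval_reg ?eval_const // d1.
  rewrite /= /upd eqxx d1; split; last by case: b {fb d1}.
  by split=> //= r rd; rewrite /upd; case: eqP => [|_]; [lia|exact: r1].
- case/andP=> wf wg [b1 [fb1 gb]]; rewrite -addnA; apply: run_seq.
  apply: run_weaken (IHf _ _ _ _ scd wf fb1) _ _ => // st1 [s1 d1].
  apply: (@run_weaken _ _ _ (1 + (ftime g).+1).+1); [|lia|by move=> ? H; exact: H].
  apply: run_if; first by apply: eval_reg; rewrite d1.
    rewrite d1; case: b1 gb {fb1 d1} => // gb _.
    have gb1 : fsem d st1 g b.
      by case: (s1) => _ m1 _; exact: fsem_same (ssc _ _ _ _ scd s1) m1 wg gb.
    apply: run_weaken (IHg _ _ _ _ scd wg gb1) _ _; first by lia.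
    by move=> st2 [s2 d2]; split=> //; exact: same_below_trans s1 s2.
  rewrite d1; case: b1 gb {fb1} d1 => // -> d1 _.
  by apply: run_skip.
case/and3P=> wlo hd wf [l [P [lol /andP[lh hW] llen fP Pb]]].
have dh := allP scd _ hd.
have dlo : {in sc, regs (set_reg st d 0) =1 regs st}.
  by move=> r /(allP scd) rd; rewrite /= /upd; case: eqP => //; lia.
apply: (@run_weaken _ _ _ (2 + (expr_cost lo + len h * (ftime f + 13) + 5)));
  [|lia|by move=> ? H; exact: H].
apply: run_seq; apply: run_assign; first exact: eval_const.
  by [].
(* Register [d] accumulates the disjunction over the values already visited. *)
pose I i st1 := [/\ same_below d st st1
                  & regs st1 d = has P (index_iota l i)].
apply: (@run_for _ W_gt1 _ _ _ _ _ l (regs st h) (ftime f + 5) I) => //.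
- by rewrite (eval_same dlo erefl wlo).
- by rewrite /= /upd; case: eqP => //; lia.
- by apply/eqP; lia.
- rewrite /I /index_iota subnn /= /upd; split.
    split=> //= r rd; rewrite /upd; case: eqP => [|_]; first by lia.
    by case: eqP => //; lia.
  by case: eqP => [|_]; [lia|rewrite eqxx].
- move=> i st1 iB ri hE [s1 d1]; apply: run_seq.
  have fi : fsem d.+2 st1 f (P i).
    apply: (@fsem_same _ (d.+1 :: sc) (set_reg st d.+1 i)); last exact: fP.
    - move=> r; rewrite inE /= /upd; case: eqP => [->//|_] /= rsc.
      by case: s1 => ->//; exact: (allP scd).
    - by case: s1.
    - exact: wf.
  have scd2 : all (fun r => r < d.+2) (d.+1 :: sc).
    by rewrite /= ltnSn; apply: sub_all scd => r; lia.
  apply: run_weaken (IHf _ _ _ _ scd2 wf fi) _ _ => // st2 [s2 d2].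
  have s12 : same_below d st st2 by apply: same_below_trans s1 s2; lia.
  have [r2 m2 o2] := s2.
  have hE2 : regs st2 h = regs st h by rewrite r2 ?hE //; lia.
  have rE2 : regs st2 d.+1 = i by rewrite r2 ?ri //; lia.
  have dE2 : regs st2 d = has P (index_iota l i) by rewrite r2 ?d1 //; lia.
  have hasS : has P (index_iota l i.+1) = has P (index_iota l i) || P i.
    rewrite /index_iota subSn; last by case/andP: iB.
    rewrite -addn1 iotaD has_cat /= orbF subnKC //; by case/andP: iB.
  apply: (@run_weaken _ _ _ (1 + 3).+1); [|lia|by move=> ? H; exact: H].
  apply: run_if; first by apply: eval_reg; rewrite d2.
    rewrite d2 => Pi; apply: run_assign; first exact: eval_const.
      by [].
    split=> //.
    + by rewrite /= /upd rE2; case: eqP; lia.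
    + by rewrite /= /upd; case: eqP; lia.
    split; last first.
      by rewrite /= /upd hasS eqxx; case: (P i) Pi; rewrite ?orbT //=; case: eqP; lia.
    case: s12 => r12 m12 o12; split=> //= r rd; rewrite /upd.
    by case: eqP => [|_]; [lia|case: eqP => [|_]; [lia|exact: r12]].
  rewrite d2 => Pi; apply: run_skip => //; split=> //.
  split; last by rewrite /= /upd hasS; case: (P i) Pi; rewrite ?orbF //=; case: eqP; lia.
  case: s12 => r12 m12 o12; split=> //= r rd; rewrite /upd.
  by case: eqP => [|_]; [lia|exact: r12].
- move=> st1 [s1 d1] _ _; split=> //; rewrite d1; congr nat_of_bool.
  apply/hasP/idP => [[w wi Pw]|/Pb[w wi Pw]].
    by apply/Pb; exists w => //; rewrite -mem_index_iota.
  by exists w => //; rewrite mem_index_iota.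
have : (regs st h - l) * (ftime f + 13) <= len h * (ftime f + 13) by exact: leq_mul.
by lia.
Qed.

End Formulas.

(** * The enumeration program *)

Lemma nth_allpairs (S T R : Type) (f : S -> T -> R) a b c s t i j :
  i < size s -> j < size t ->
  nth c [seq f x y | x <- s, y <- t] (i * size t + j) = f (nth a s i) (nth b t j).
Proof.
elim: s i => [//|x s IHs] i ilt jlt /=; rewrite nth_cat size_map.
case: i ilt => [|i] ilt; first by rewrite mul0n jlt (nth_map b).
by rewrite ifN ?mulSn -?addnA ?addKn ?IHs // -leqNgt leq_addr.
Qed.

(* Registers: number of vertices [n], [2 * n], first free row, current row,
   loop variables. Registers from [rd] on belong to compiled formulas. *)
Local Notation rn := 0 (only parsing).
Local Notation rnn := 1 (only parsing).
Local Notation rc := 2 (only parsing).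
Local Notation rq := 3 (only parsing).
Local Notation rv := 4 (only parsing).
Local Notation ru := 5 (only parsing).
Local Notation rs := 6 (only parsing).
Local Notation rt := 7 (only parsing).
Local Notation rk := 8 (only parsing).
Local Notation rd := 10 (only parsing).

(* After the word [n], the memory is a sequence of rows of length [n]: first the
   adjacency matrix, then the [n] rows of the distance table, then the
   characteristic vectors of the sets found so far. *)
Definition addr (row col : expr) : expr :=
  Op OpAdd (Const 1) (Op OpAdd (Op OpMul row (Reg rn)) col).

Definition entry (row col : expr) : expr := Defs.Mem (addr row col).

Definition daddr (a b : expr) : expr := addr (Op OpAdd (Reg rn) a) b.
Definition dentry (a b : expr) : expr := Defs.Mem (daddr a b).

Definition succ (a : expr) : expr := Op OpAdd a (Const 1).

(** The test of [trunc_dcode_step], read from the table: the pair is not yet reached and some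
    neighbour has code [k.+1]. *)
Definition next_dist : form :=
  FAnd (FE (Op OpEq (dentry (Reg rs) (Reg rt)) (Const 0)))
       (FEx (Const 0) rn
          (FAnd (FE (entry (Reg rs) (Reg rd.+1)))
                (FE (Op OpEq (dentry (Reg rd.+1) (Reg rt)) (succ (Reg rk)))))).

(** [locally_metric] for row [rc], with universal quantifiers as negated existential ones. Each
    quantifier takes two registers, so [s], [t], [w] are [rd.+1], [rd.+3], [rd.+4.+1]. *)
Definition is_metric : form :=
  FNot (FEx (Const 0) rn (FEx (Const 0) rn
    (FAnd (FAnd (FE (entry (Reg rc) (Reg rd.+1)))
                (FE (entry (Reg rc) (Reg rd.+3))))
    (FAnd (FE (Op OpLt (Const 1) (dentry (Reg rd.+1) (Reg rd.+3))))
    (FNot (FEx (Const 0) rn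
      (FAnd (FE (entry (Reg rc) (Reg rd.+4.+1)))
      (FAnd (FE (entry (Reg rd.+1) (Reg rd.+4.+1)))
            (FE (Op OpEq (succ (dentry (Reg rd.+4.+1) (Reg rd.+3)))
                         (dentry (Reg rd.+1) (Reg rd.+3)))))))))))).

Definition is_listed : form :=
  FEx (Reg rnn) rc
    (FNot (FEx (Const 0) rn
      (FNot (FE (Op OpEq (entry (Reg rd.+1) (Reg rd.+3))
                         (entry (Reg rc) (Reg rd.+3))))))).

Definition is_new : form := FAnd is_metric (FNot is_listed).

Definition init_prog : cmd :=
  Seq (Assign rn (Defs.Mem (Const 0))) (Assign rnn (Op OpAdd (Reg rn) (Reg rn))).

Definition diag_prog : cmd :=
  For rs (Const 0) rn (Store (daddr (Reg rs) (Reg rs)) (Const 1)).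

Definition dist_prog : cmd :=
  For rk (Const 0) rn
    (For rs (Const 0) rn
      (For rt (Const 0) rn
        (Seq (compile rd next_dist)
             (If (Reg rd)
                 (Store (daddr (Reg rs) (Reg rt)) (succ (succ (Reg rk))))
                 Skip)))).

(** The candidate is built in row [rc], just past the listed rows, so accepting it amounts to
    incrementing [rc]; a rejected one is overwritten by the next. *)
Definition extend_prog : cmd :=
  Seq (For ru (Const 0) rn
         (Store (addr (Reg rc) (Reg ru))
                (Op OpLt (Const 0)
                    (Op OpAdd (entry (Reg rq) (Reg ru))
                              (Op OpEq (Reg ru) (Reg rv))))))
      (Seq (compile rd is_new) (If (Reg rd) (Assign rc (succ (Reg rc))) Skip)).

(** Row [2 * n] is zero from the start and thus already encodes the empty set. The listed rows
    double as the queue, with [rq] at its head; [rc] grows meanwhile, which rules out [For]. *)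
Definition search_prog : cmd :=
  Seq (Assign rc (succ (Reg rnn)))
  (Seq (Assign rq (Reg rnn))
    (While (Op OpLt (Reg rq) (Reg rc))
       (Seq (For rv (Const 0) rn extend_prog) (Assign rq (succ (Reg rq)))))).

Definition print_prog : cmd :=
  For rq (Reg rnn) rc
    (Seq (For rv (Const 0) rn
            (If (entry (Reg rq) (Reg rv)) (Print (succ (Reg rv))) Skip))
         (Print (Const 0))).

Definition enum_prog : cmd :=
  Seq init_prog (Seq diag_prog (Seq dist_prog (Seq search_prog print_prog))).

(** * Memory layout and word size *)

Section Verification.
Variables (V : finType) (e : rel V).
Implicit Types (X Y : {set V}) (u v w : V) (L : seq {set V}) (st : state).
Implicit Types (m : nat -> nat) (D : V -> V -> nat).
Let n := #|V|.
Let N := #|AccMet e|.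
Variable W : nat.
Hypothesis W_large : 4 * (n + N + 2) ^ 2 < W.

Definition rank v : nat := enum_rank v.

Lemma rank_lt v : rank v < n. Proof. exact: ltn_ord. Qed.

Lemma rank_inj : injective rank.
Proof. by move=> u v /ord_inj/enum_rank_inj. Qed.

Lemma rank_surj i : i < n -> exists v, i = rank v.
Proof. by move=> lt_in; exists (enum_val (Ordinal lt_in)); rewrite /rank enum_valK. Qed.

Lemma W_linear x : x <= 3 * (n + N + 2) -> x < W.
Proof.
move=> xle; apply: leq_ltn_trans W_large; apply: leq_trans xle _.
by rewrite expnS expn1; nia.
Qed.

(** Row [n + n + N] is the candidate row behind a full list. Addresses are the only quadratic
    quantities, and [W_large] is chosen for them. *)
Lemma W_addr r c : r <= n + n + N -> c <= n -> (r * n + c).+1 < W.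
Proof.
move=> rle cle; apply: leq_ltn_trans W_large.
have : r * n <= (n + n + N) * n by exact: leq_mul.
by rewrite expnS expn1; nia.
Qed.

Lemma W_gt1 : 1 < W. Proof. by apply: W_linear; lia. Qed.
Hint Resolve W_gt1 : core.

Definition cell m r c : nat := m (r * n + c).+1.

(** For columns below [n], row and column are the quotient and remainder of the offset by [n], so
    distinct cells do not overlap. *)
Lemma cell_set_mem st r c r' c' x : c < n -> c' < n ->
  cell (memory (set_mem st (r * n + c).+1 x)) r' c' =
    if (r' == r) && (c' == c) then x else cell (memory st) r' c'.
Proof.
move=> cn c'n; rewrite /cell /= /upd eqSS; congr (if _ then _ else _).
apply/eqP/andP => [E|[/eqP-> /eqP->]//].
suff [-> ->] : r' = r /\ c' = c by [].
have := congr1 (divn^~ n) E; have := congr1 (modn^~ n) E.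
have n0 : 0 < n by lia.
by rewrite !modnMDl !divnMDl // !modn_small // !divn_small // !addn0.
Qed.

Lemma eval_regE st r x : regs st r = x -> x < W -> eval W st (Reg r) = Some x.
Proof. by move=> <-; exact: eval_reg. Qed.

Lemma eval_rank st r v : regs st r = rank v -> eval W st (Reg r) = Some (rank v).
Proof. by move=> /eval_regE; apply; apply: W_linear; have := rank_lt v; lia. Qed.

Lemma eval_succ st a x :
  eval W st a = Some x -> x.+1 < W -> eval W st (succ a) = Some x.+1.
Proof.
move=> ax xW; rewrite -addn1; apply: (@eval_op _ _ OpAdd) => //=.
  by apply: eval_const.
by rewrite addn1.
Qed.

Lemma eval_addr st a b r c : regs st rn = n ->
  eval W st a = Some r -> eval W st b = Some c -> r <= n + n + N -> c <= n ->
  eval W st (addr a b) = Some (r * n + c).+1.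
Proof.
move=> st_n ar bc rle cle; have := W_addr rle cle => lt_W.
apply: (@eval_op _ _ OpAdd _ _ 1); rewrite ?eval_const //.
apply: (@eval_op _ _ OpAdd) => //; last by rewrite /=; lia.
apply: (@eval_op _ _ OpMul) => //=; last by lia.
by apply: eval_regE => //; apply: W_linear; lia.
Qed.

Lemma eval_entry st a b r c : regs st rn = n ->
  eval W st a = Some r -> eval W st b = Some c -> r <= n + n + N -> c <= n ->
  cell (memory st) r c < W ->
  eval W st (entry a b) = Some (cell (memory st) r c).
Proof. by move=> *; apply: eval_mem => //; exact: eval_addr. Qed.

Definition adj_rows m : Prop := forall u v, cell m (rank u) (rank v) = e u v.

Definition dist_rows m D : Prop :=
  forall u v, cell m (n + rank u) (rank v) = D u v.

Definition set_row m r X : Prop := forall v, cell m r (rank v) = (v \in X).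

Lemma bool_lt_W (b : bool) : b < W.
Proof. by case: b => //; exact: ltnW. Qed.
Hint Resolve bool_lt_W : core.

Lemma eval_adj st a b u v : regs st rn = n -> adj_rows (memory st) ->
  eval W st a = Some (rank u) -> eval W st b = Some (rank v) ->
  eval W st (entry a b) = Some (nat_of_bool (e u v)).
Proof.
move=> st_n adj au bv; have [lt_u lt_v] := (rank_lt u, rank_lt v).
by rewrite -adj; apply: eval_entry => //; rewrite ?adj //; lia.
Qed.

Lemma eval_daddr st a b u v : regs st rn = n ->
  eval W st a = Some (rank u) -> eval W st b = Some (rank v) ->
  eval W st (daddr a b) = Some ((n + rank u) * n + rank v).+1.
Proof.
move=> st_n au bv; have [lt_u lt_v] := (rank_lt u, rank_lt v).
apply: eval_addr => //; try by lia.
apply: (@eval_op _ _ OpAdd) => //=; last by apply: W_linear; lia.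
by apply: eval_regE => //; apply: W_linear; lia.
Qed.

Lemma eval_dist st a b u v D : regs st rn = n -> dist_rows (memory st) D ->
  eval W st a = Some (rank u) -> eval W st b = Some (rank v) -> D u v <= n ->
  eval W st (dentry a b) = Some (D u v).
Proof.
move=> st_n dD au bv Dn; rewrite -dD; apply: eval_mem; first exact: eval_daddr.
by rewrite -/(cell _ _ _) dD; apply: W_linear; lia.
Qed.

Lemma eval_set st a b r X v : regs st rn = n -> set_row (memory st) r X ->
  eval W st a = Some r -> r <= n + n + N -> eval W st b = Some (rank v) ->
  eval W st (entry a b) = Some (nat_of_bool (v \in X)).
Proof.
move=> st_n rX ar rle bv; have lt_v := rank_lt v.
by rewrite -rX; apply: eval_entry => //; rewrite ?rX //; lia.
Qed.

(** Quantifiers range either over vertices, up to register [rn], which is 0, or over listed rows, up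
    to [rc]. *)
Definition range_len (h : nat) : nat := if h is 0 then n else N.

(** Carries a quantifier over register values below [n] to one over vertices, along [rank]. *)
Lemma fsem_exV d st f (Q : pred V) : regs st rn = n ->
  (forall v, fsem W range_len d.+2 (set_reg st d.+1 (rank v)) f (Q v)) ->
  fsem W range_len d st (FEx (Const 0) rn f) [exists v, Q v].
Proof.
move=> st_n fQ; exists 0, (fun i => [exists v, (rank v == i) && Q v]).
rewrite st_n subn0; split=> //.
- by apply: eval_const; exact: ltnW.
- by apply: W_linear; lia.
- move=> i /rank_surj[v ->].
  suff -> : [exists u, (rank u == rank v) && Q u] = Q v by [].
  apply/existsP/idP => [[u /andP[/eqP/rank_inj->]]//|Qv].
  by exists v; rewrite eqxx.
split=> [/existsP[v Qv]|[i _ /existsP[v /andP[_ Qv]]]]; last by apply/existsP; exists v.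
by exists (rank v); [exact: rank_lt|apply/existsP; exists v; rewrite eqxx].
Qed.

Lemma fsem_next_dist st D u v k :
  regs st rn = n -> adj_rows (memory st) -> dist_rows (memory st) D ->
  (forall a b, D a b <= n) ->
  regs st rs = rank u -> regs st rt = rank v -> regs st rk = k -> k < n ->
  fsem W range_len rd st next_dist
    ((D u v == 0) && [exists w, e u w && (D w v == k.+1)]).
Proof.
move=> st_n adj dD Dn st_u st_v st_k kn; apply: fsem_and.
  apply: fsem_bool; apply: eval_eq_op => //; last by apply: eval_const; exact: ltnW.
  by apply: eval_dist => //; exact: eval_rank.
apply: fsem_exV => // w; apply: fsem_and; apply: fsem_bool.
  by apply: eval_adj => //; exact: eval_rank.
apply: eval_eq_op => //; first by apply: eval_dist => //; exact: eval_rank.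
by apply: eval_succ; [apply: eval_regE|]; rewrite //; apply: W_linear; lia.
Qed.

(** * Computing the distance table *)

(** Row [n + n] is tracked because the search relies on it as the empty set. *)
Definition table_inv st D : Prop :=
  [/\ regs st rn = n /\ regs st rnn = n + n, adj_rows (memory st),
      dist_rows (memory st) D, set_row (memory st) (n + n) set0
    & output st = [::]].

Lemma table_inv_reg st D r x : 1 < r -> table_inv st D -> table_inv (set_reg st r x) D.
Proof.
case: r => [|[|r]] // _ [[n1 n2] adj dD row0 out]; split=> //.
Qed.

Lemma table_inv_ext st D D' : D =2 D' -> table_inv st D -> table_inv st D'.
Proof. by move=> DD' [? ? dD ? ?]; split=> // u v; rewrite dD DD'. Qed.

Lemma table_inv_set st D u v x : table_inv st D ->
  table_inv (set_mem st ((n + rank u) * n + rank v).+1 x)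
            (fun a b => if (a == u) && (b == v) then x else D a b).
Proof.
case=> [regE adj dD row0 out]; split=> //.
- move=> a b; rewrite cell_set_mem ?rank_lt // adj.
  by case: eqP => // E; have := rank_lt a; lia.
- move=> a b; rewrite cell_set_mem ?rank_lt // dD eqn_add2l.
  by rewrite !(inj_eq rank_inj).
move=> b; rewrite cell_set_mem ?rank_lt // row0.
by case: eqP => // E; have := rank_lt u; lia.
Qed.

Lemma table_inv_same st st' D :
  same_below rd st st' -> table_inv st D -> table_inv st' D.
Proof.
by case=> rE mE oE [[n1 n2] adj dD row0 out]; split; rewrite ?mE ?oE // !rE.
Qed.

Lemma run_diag st : table_inv st (fun _ _ => 0) ->
  run W diag_prog st (n * 20 + 6)
    (fun st' => table_inv st' (fun u v => trunc 1 (dcode e u v))).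
Proof.
move=> inv0; have [[st_n _] _ _ _ _] := inv0.
have nW : n < W by apply: W_linear; lia.
pose I i st1 := table_inv st1 (fun u v => (u == v) && (rank u < i)).
apply: (@run_for _ W_gt1 _ _ _ _ _ 0 n 12 I) => //.
- by apply: eval_const; exact: ltnW.
- by apply: table_inv_reg => //; apply: table_inv_ext inv0 => u v; rewrite andbF.
- move=> i st1 /rank_surj[u ->] st1_u st1_n inv1.
  apply: run_store.
  + exact: eval_daddr st1_n (eval_rank st1_u) (eval_rank st1_u).
  + exact: eval_const.
  + by [].
  split=> //; apply: table_inv_reg => //.
  apply: table_inv_ext (table_inv_set u u 1 inv1) => a b.
  rewrite ltnS [in RHS]leq_eqVlt (inj_eq rank_inj).
  case: (eqVneq a u) => [->|_] //=.
  by rewrite ltnn andbF [b == u]eq_sym andbT; case: eqP.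
- move=> st1 inv1 _ _; apply: table_inv_ext inv1 => a b.
  rewrite rank_lt andbT /trunc -(dcode_eq1 e).
  by case: (dcode e a b) => [|[|k]].
by rewrite subn0 /=; lia.
Qed.

Definition dist_time3 := n * (ftime range_len next_dist + 28) + 6.
Definition dist_time2 := n * (dist_time3 + 8) + 6.
Definition dist_time := n * (dist_time2 + 8) + 6.

Lemma run_dist_entry st u v k D :
  regs st rs = rank u -> regs st rt = rank v -> regs st rk = k -> k < n ->
  table_inv st D -> (forall a b, D a b <= n) ->
  run W (Seq (compile rd next_dist)
             (If (Reg rd)
                 (Store (daddr (Reg rs) (Reg rt)) (succ (succ (Reg rk)))) Skip))
    st (ftime range_len next_dist + 20)
    (fun st' => [/\ forall r, r < rd -> regs st' r = regs st r
      & table_inv st' (fun a b => if (a == u) && (b == v) then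
          if (D u v == 0) && [exists w, e u w && (D w v == k.+1)]
          then k.+2 else D u v else D a b)]).
Proof.
move=> st_u st_v st_k kn inv Dn; have [[st_n _] adj dD _ _] := inv.
have F := fsem_next_dist st_n adj dD Dn st_u st_v st_k kn.
apply: run_seq.
apply: run_weaken (run_compile W_gt1 (sc := iota 0 10) _ _ F) _ _ => //.
move=> st1 [same1 st1_d].
have [rE mE oE] := same1; have inv1 := table_inv_same same1 inv.
apply: (run_time (T := (1 + 16).+1)) => //.
apply: run_if; first by apply: eval_regE; [exact: st1_d|].
  case: ifP st1_d => // cond _ _; apply: run_store.
  + by apply: (@eval_daddr _ _ _ u v); rewrite ?rE //; apply: eval_rank; rewrite rE.
  + have kW : k.+2 < W by apply: W_linear; lia.
    apply: (eval_succ (x := k.+1)) => //; apply: eval_succ; last exact: ltnW.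
    by apply: eval_regE; [rewrite rE ?st_k|do 2 apply: ltnW].
  + by [].
  split=> //.
  by apply: table_inv_ext (table_inv_set u v k.+2 inv1) => a b.
case: ifP st1_d => // cond _ _; apply: run_skip => //; split=> //.
apply: table_inv_ext inv1 => a b.
by case: (eqVneq a u) => //= ->; case: eqP => // ->.
Qed.

Lemma run_dist st : table_inv st (fun u v => trunc 1 (dcode e u v)) ->
  run W dist_prog st dist_time (fun st' => table_inv st' (dcode e)).
Proof.
move=> inv0; have [[st_n _] _ _ _ _] := inv0.
have nW : n < W by apply: W_linear; lia.
have W0 : 0 < W by exact: ltnW.
pose I k st1 := table_inv st1 (fun u v => trunc k.+1 (dcode e u v)).
apply: (@run_for _ W_gt1 _ _ _ _ _ 0 n dist_time2 I) => //.
- exact: eval_const.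
- move=> k st1 kn st1_k st1_n inv1.
  pose J i st2 := regs st2 rk = k /\ table_inv st2 (fun u v =>
    trunc (if rank u < i then k.+2 else k.+1) (dcode e u v)).
  apply: (@run_for _ W_gt1 _ _ _ _ _ 0 n dist_time3 J) => //.
  + exact: eval_const.
  + move=> i st2 /rank_surj[u ->] st2_u st2_n [st2_k inv2].
    (* In the middle of a round, the entries already visited in row-major order have bound [k.+2]
       and the others [k.+1]. *)
    pose K j st3 := [/\ regs st3 rk = k, regs st3 rs = rank u
      & table_inv st3 (fun a b =>
          trunc (if (rank a < rank u) || (a == u) && (rank b < j)
                 then k.+2 else k.+1) (dcode e a b))].
    apply: (@run_for _ W_gt1 _ _ _ _ _ 0 n (ftime range_len next_dist + 20) K) => //.
    * exact: eval_const.
    * split=> //; apply: table_inv_reg => //; apply: table_inv_ext inv2 => a b.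
      by rewrite ltn0 andbF orbF.
    * move=> j st3 /rank_surj[v ->] st3_v st3_n [st3_k st3_u inv3].
      apply: run_weaken (run_dist_entry st3_u st3_v st3_k kn inv3 _) _ _ => //.
        by move=> a b; apply: leq_trans (trunc_le _ _) (dcode_le _ _ _).
      move=> st4 [rE inv4]; rewrite !rE //; split=> //; split=> //=; rewrite /upd /= ?rE //.
      apply: table_inv_reg => //; apply: table_inv_ext inv4 => a b.
      rewrite !eqxx !ltnn /=.
      have -> : [exists w, e u w && (trunc (if (rank w < rank u) || (w == u) && false
          then k.+2 else k.+1) (dcode e w v) == k.+1)]
        = [exists w, e u w && (dcode e w v == k.+1)].
        apply: eq_existsb => w; congr (_ && _); rewrite /trunc andbF orbF.
        by case: (rank w < rank u); case: ifP => H; apply/eqP/eqP; lia.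
      rewrite -trunc_dcode_step ltnS (leq_eqVlt (rank b)) (inj_eq rank_inj).
      case: (eqVneq a u) => [->|] //=; case: (eqVneq b v) => [->|] //=.
      by rewrite orbT.
    * move=> st3 [st3_k st3_u inv3] _ st3_n; split=> //; split=> //.
      apply: table_inv_reg => //; apply: table_inv_ext inv3 => a b.
      by rewrite rank_lt andbT ltnS [in RHS]leq_eqVlt (inj_eq rank_inj) orbC.
    by rewrite subn0 /dist_time3 /=; lia.
  + move=> st2 [st2_k inv2] st2_s st2_n; split=> //.
    apply: table_inv_reg => //; apply: table_inv_ext inv2 => a b.
    by rewrite rank_lt.
  by rewrite subn0 /dist_time2 /=; lia.
- move=> st1 inv1 _ _; apply: table_inv_ext inv1 => a b.
  by rewrite /trunc (leq_trans (dcode_le _ _ _)).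
by rewrite subn0 /dist_time /=; lia.
Qed.

(** * Breadth-first search *)

(** Nothing is said about row [n + n + size L], which is scratch space for the candidate. *)
Definition list_inv st L : Prop :=
  [/\ [/\ regs st rn = n, regs st rnn = n + n & regs st rc = n + n + size L],
      adj_rows (memory st), dist_rows (memory st) (dcode e),
      forall i, i < size L -> set_row (memory st) (n + n + i) (nth set0 L i)
    & output st = [::]].

Definition good_list L : Prop :=
  [/\ uniq L, {subset L <= AccMet e} & set0 \in L].

(** Soundness of the list matters during the search and not only at its end: it bounds the number of
    rows, hence addresses, comparison time and rounds. *)
Lemma good_list_size L : good_list L -> size L <= N.
Proof.
case=> uL sL _; rewrite /N cardE; apply: uniq_leq_size => // X /sL.
by rewrite mem_enum.
Qed.

Lemma list_inv_reg st L r x : 2 < r -> list_inv st L -> list_inv (set_reg st r x) L.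
Proof. by case: r => [|[|[|r]]] // _ [[n1 n2 n3] ? ? ? ?]; split. Qed.

Lemma list_inv_same st st' L :
  same_below rd st st' -> list_inv st L -> list_inv st' L.
Proof.
case=> rE mE oE [[n1 n2 n3] adj dD rows out].
by split; rewrite ?mE ?oE //; split; rewrite rE.
Qed.

Lemma list_inv_set st L u x : list_inv st L ->
  list_inv (set_mem st ((n + n + size L) * n + rank u).+1 x) L.
Proof.
case=> regE adj dD rows out; split=> //.
- move=> a b; rewrite cell_set_mem ?rank_lt // adj.
  by case: eqP => // E; have := rank_lt a; lia.
- move=> a b; rewrite cell_set_mem ?rank_lt // dD.
  by case: eqP => // E; have := rank_lt a; lia.
move=> i iL a; rewrite cell_set_mem ?rank_lt // rows //.
by case: eqP => // E; lia.
Qed.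

Lemma fsem_is_metric st L X :
  list_inv st L -> size L <= N -> set_row (memory st) (n + n + size L) X ->
  fsem W range_len rd st is_metric (metric e X).
Proof.
case=> [[st_n _ st_c] adj dD _ _] LN rX.
have st_cW : n + n + size L < W by apply: W_linear; lia.
have -> : metric e X = ~~ [exists s, exists t, ((s \in X) && (t \in X)) &&
    ((1 < dcode e s t) && ~~ [exists w, (w \in X) && (e s w &&
       ((dcode e w t).+1 == dcode e s t))])].
  rewrite metricE negb_exists; apply: eq_forallb => s.
  rewrite negb_exists; case: (s \in X) => /=; last by apply/esym/forallP.
  apply: eq_forallb => t.
  by case: (t \in X) => //=; case: (1 < _) => //=; rewrite negbK.
apply: fsem_not; apply: fsem_exV => // s; apply: fsem_exV => // t.
apply: fsem_and; first apply: fsem_and; try apply: fsem_bool.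
- by apply: (eval_set (r := n + n + size L)); rewrite ?leq_add2l //;
    [exact: eval_regE|exact: eval_rank].
- by apply: (eval_set (r := n + n + size L)); rewrite ?leq_add2l //;
    [exact: eval_regE|exact: eval_rank].
apply: fsem_and.
  apply: fsem_bool; apply: eval_lt_op => //; first exact: eval_const.
  by apply: eval_dist => //; [exact: eval_rank|exact: eval_rank|exact: dcode_le].
apply: fsem_not; apply: fsem_exV => // w.
apply: fsem_and; last apply: fsem_and; apply: fsem_bool.
- by apply: (eval_set (r := n + n + size L)); rewrite ?leq_add2l //;
    [exact: eval_regE|exact: eval_rank].
- by apply: eval_adj => //; exact: eval_rank.
apply: eval_eq_op => //; last first.
  by apply: eval_dist => //; [exact: eval_rank|exact: eval_rank|exact: dcode_le].
apply: eval_succ; last first.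
  by apply: W_linear; have := dcode_le e w t; rewrite -/n; lia.
by apply: eval_dist => //; [exact: eval_rank|exact: eval_rank|exact: dcode_le].
Qed.

Lemma fsem_is_listed st L X :
  list_inv st L -> size L <= N -> set_row (memory st) (n + n + size L) X ->
  fsem W range_len rd st is_listed (X \in L).
Proof.
case=> [[st_n st_nn st_c] adj dD rows _] LN rX.
have st_cW : n + n + size L < W by apply: W_linear; lia.
exists (n + n), (fun j => nth set0 L (j - (n + n)) == X).
rewrite st_c; split.
- by apply: eval_regE => //; apply: W_linear; lia.
- by rewrite leq_addr.
- by rewrite /= ; lia.
- move=> j jL; set Y := nth _ _ _.
  have jW : j < W by case/andP: jL => _ jL; exact: ltn_trans jL _.
  have rY : set_row (memory st) j Y.
    have := rows (j - (n + n)); rewrite subnKC; last by lia.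
    by apply; lia.
  have -> : (Y == X) = ~~ [exists v, ~~ ((v \in Y : nat) == (v \in X))].
    rewrite negb_exists; apply/eqP/forallP => [-> v|YX]; first by rewrite eqxx.
    apply/setP=> v; move: (YX v); rewrite negbK.
    by case: (v \in Y); case: (v \in X).
  apply: fsem_not; apply: fsem_exV => // v; apply: fsem_not; apply: fsem_bool.
  apply: eval_eq_op => //.
    by apply: (eval_set (r := j)) => //; [exact: eval_regE|lia|exact: eval_rank].
  by apply: (eval_set (r := n + n + size L)); rewrite ?leq_add2l //;
    [exact: eval_regE|exact: eval_rank].
split=> [XL|[j /andP[j1 j2] /eqP<-]]; last by rewrite mem_nth // ltn_subLR.
exists (n + n + index X L); first by rewrite leq_addr ltn_add2l index_mem.
by rewrite addKn nth_index.
Qed.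

Definition extend_time := n * 48 + 6 + (ftime range_len is_new + 10).

(** The list only grows at its end, so positions of listed sets, and closure already achieved,
    persist. *)
Lemma run_extend st L q v :
  list_inv st L -> good_list L -> q < size L ->
  regs st rq = n + n + q -> regs st rv = rank v ->
  run W extend_prog st extend_time (fun st' => exists L',
    [/\ list_inv st' L' /\ good_list L', regs st' rq = n + n + q,
        regs st' rv = rank v, L' = L \/ exists X, L' = rcons L X
      & metric e (v |: nth set0 L q) -> v |: nth set0 L q \in L']).
Proof.
move=> inv0 gL qL st_q st_v; have LN := good_list_size gL.
set X := v |: _.
have nW : n < W by apply: W_linear; lia.
have W0 : 0 < W by exact: ltnW.
have [[st_n _ _] _ _ _ _] := inv0.
have cW : n + n + size L < W by apply: W_linear; lia.
apply: run_seq.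
pose I i st1 := [/\ list_inv st1 L, regs st1 rq = n + n + q, regs st1 rv = rank v
  & forall u, rank u < i ->
      cell (memory st1) (n + n + size L) (rank u) = (u \in X)].
apply: (@run_for _ W_gt1 _ _ _ _ _ 0 n 40 I) => //.
- exact: eval_const.
- move=> i st1 /rank_surj[u ->] st1_u st1_n [inv1 st1_q st1_v row1].
  have [[_ _ st1_c] _ _ rows1 _] := inv1.
  have qW : n + n + q < W by apply: W_linear; lia.
  have ltu := rank_lt u.
  have uX : (0 < (u \in nth set0 L q) + (rank u == rank v)) = (u \in X).
    rewrite in_setU1 (inj_eq rank_inj).
    by case: (u == v); case: (u \in _).
  apply: run_store.
  + apply: (@eval_addr _ _ _ (n + n + size L) (rank u)) => //;
      [exact: eval_regE|exact: eval_rank|by rewrite leq_add2l|exact: ltnW].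
  + apply: eval_lt_op => //; first exact: eval_const.
    apply: (@eval_op _ _ OpAdd).
    * apply: (eval_set (v := u) _ (rows1 _ qL)) => //;
        [exact: eval_regE|lia|exact: eval_rank].
    * exact: eval_eq_op (eval_rank st1_u) (eval_rank st1_v).
    by apply: W_linear; case: (u \in _); case: (rank u == _) => /=; lia.
  + by [].
  split=> //; split=> //.
    by apply: list_inv_reg => //; exact: list_inv_set.
  move=> a; rewrite ltnS leq_eqVlt (inj_eq rank_inj) => au.
  rewrite cell_set_mem ?rank_lt // eqxx (inj_eq rank_inj) /=.
  case: eqP au => [-> _|_ /= au]; first by rewrite uX.
  exact: row1.
- move=> st1 [inv1 st1_q st1_v row1] _ _.
  have rX : set_row (memory st1) (n + n + size L) X.
    by move=> u; rewrite row1 ?rank_lt.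
  have F : fsem W range_len rd st1 is_new (metric e X && (X \notin L)).
    apply: fsem_and; first exact: fsem_is_metric inv1 LN rX.
    by apply: fsem_not; exact: fsem_is_listed inv1 LN rX.
  apply: run_seq.
  apply: run_weaken (run_compile W_gt1 (sc := iota 0 10) _ _ F) _ _ => //.
  move=> st2 [same2 st2_d]; have inv2 := list_inv_same same2 inv1.
  have [rE mE oE] := same2.
  have st2_q : regs st2 rq = n + n + q by rewrite rE.
  have st2_v : regs st2 rv = rank v by rewrite rE.
  apply: (run_time (T := (1 + 5).+1)) => //.
  apply: run_if; first by apply: eval_regE; [exact: st2_d|].
    case: andP st2_d => // -[mX XL] _ _.
    have [[st2_n st2_nn st2_c] adj dD rows out] := inv2.
    have accX : X \in AccMet e.
      rewrite inE; apply: accessibleU1 => //.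
      by case: gL => _ /(_ _ (mem_nth set0 qL)) + _; rewrite inE.
    have gLX : good_list (rcons L X).
      case: gL => uL sL L0; split.
      - by rewrite rcons_uniq XL.
      - by move=> Y; rewrite mem_rcons inE => /orP[/eqP->|/sL].
      by rewrite mem_rcons inE L0 orbT.
    apply: run_assign.
    + apply: eval_succ; first by apply: eval_regE; [exact: st2_c|].
      by have := good_list_size gLX; rewrite size_rcons => ?; apply: W_linear; lia.
    + by [].
    exists (rcons L X); split=> //.
    + split=> //; split=> //.
        by split=> //; rewrite /= /upd /= size_rcons addnS.
      move=> i; rewrite size_rcons ltnS leq_eqVlt nth_rcons.
      case: ltnP => [iL _|_]; first exact: rows.
      rewrite orbF => /eqP->; rewrite eqxx /= mE; exact: rX.
    + by right; exists X.
    by rewrite mem_rcons mem_head.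
  case: andP st2_d => // nX _ _; apply: run_skip => //; exists L; split=> //.
    by left.
  by move=> mX; apply/negPn/negP => XL; case: nX.
by rewrite subn0 /=; lia.
Qed.

(** Progress of the loop over vertices: those of rank below [i] have been tried on the set at
    position [q]; [i = n] means full closure. *)
Definition closed_at L q (i : nat) : Prop :=
  forall v, rank v < i -> metric e (v |: nth set0 L q) ->
    v |: nth set0 L q \in L.

Lemma closed_at_rcons L X q i :
  q < size L -> closed_at L q i -> closed_at (rcons L X) q i.
Proof.
by move=> qL cl v vi; rewrite nth_rcons qL mem_rcons inE => /(cl v vi)->; rewrite orbT.
Qed.

Definition search_time := N * (n * (extend_time + 8) + 20) + 20.

Lemma run_search st : table_inv st (dcode e) ->
  run W search_prog st search_time (fun st' => exists L,
    [/\ list_inv st' L, good_list L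
      & forall q, q < size L -> closed_at L q n]).
Proof.
case=> [[st_n st_nn] adj dD row0 out].
have nW : n < W by apply: W_linear; lia.
have nnW : n + n < W by apply: W_linear; lia.
have W0 : 0 < W by exact: ltnW.
apply: (run_time (T := 4 + (2 + (N * (n * (extend_time + 8) + 6 + 4 + 3).+1 + 4)))).
  rewrite /search_time.
  have : N * (n * (extend_time + 8) + 6 + 4 + 3).+1 <=
         N * (n * (extend_time + 8) + 20) by apply: leq_mul => //; lia.
  by lia.
apply: run_seq; apply: run_assign.
- apply: eval_succ; first by apply: eval_regE; [exact: st_nn|].
  by apply: W_linear; lia.
- by [].
apply: run_seq; apply: run_assign; first by apply: eval_regE; [exact: st_nn|].
  by [].
(* The end of the queue moves, but [size L <= N] throughout, so [N - q] bounds the remaining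
   rounds. *)
pose I i st1 := exists L q,
  [/\ list_inv st1 L /\ good_list L, regs st1 rq = n + n + q, q <= size L,
      forall q', q' < q -> closed_at L q' n & i = N - q].
apply: (run_while (I := I)); last first.
  exists [:: set0], 0; split=> //.
  - split.
      split=> //.
        by split=> //; rewrite /= /upd /= addn1.
      by move=> [|//] _ v; rewrite addn0; exact: row0.
    split=> //; last by rewrite mem_head.
    by move=> X; rewrite inE => /eqP->; rewrite inE accessible0.
  - by rewrite /= /upd /= addn0.
  by rewrite subn0.
move=> i st1 [L [q [[inv1 gL] st1_q qL cl iE]]].
have [[st1_n st1_nn st1_c] _ _ _ _] := inv1.
have LN := good_list_size gL.
have ev : eval W st1 (Op OpLt (Reg rq) (Reg rc)) = Some (nat_of_bool (q < size L)).
  rewrite -(ltn_add2l (n + n)); apply: eval_lt_op => //; apply: eval_regE => //;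
  by apply: W_linear; lia.
case: (ltnP q (size L)) ev => [ltq ev|leq ev]; last first.
  left; split=> //; exists L; split=> // q' q'L; apply: cl.
  exact: leq_trans leq.
right; exists 0, (N - q.+1); split=> //; first by lia.
apply: run_seq.
pose J j st2 := exists L', [/\ list_inv st2 L' /\ good_list L',
  regs st2 rq = n + n + q, q < size L', forall q', q' < q -> closed_at L' q' n
  & closed_at L' q j].
apply: (@run_for _ W_gt1 _ _ _ _ _ 0 n extend_time J) => //.
- exact: eval_const.
- by exists L; split=> //; split=> //; exact: list_inv_reg.
- move=> j st2 /rank_surj[v ->] st2_v st2_n [L2 [[inv2 gL2] st2_q qL2 cl2 clv]].
  apply: run_weaken (run_extend inv2 gL2 qL2 st2_q st2_v) _ _ => //.
  move=> st3 [L3 [[inv3 gL3] st3_q st3_v L23 vL3]]; split=> //.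
    by case: inv3 => [[]].
  have nth23 q' : q' < size L2 -> nth set0 L3 q' = nth set0 L2 q'.
    by case: L23 => [->//|[X ->]]; rewrite nth_rcons => ->.
  have cl23 q' l : q' < size L2 -> closed_at L2 q' l -> closed_at L3 q' l.
    by case: L23 => [->//|[X ->]]; exact: closed_at_rcons.
  exists L3; split=> //.
  + by case: L23 => [->//|[X ->]]; rewrite size_rcons ltnS ltnW.
  + by move=> q' q'q; apply: cl23 (cl2 _ q'q); exact: ltn_trans qL2.
  move=> w; rewrite ltnS leq_eqVlt (inj_eq rank_inj) => /orP[/eqP->|wv].
    by rewrite nth23.
  exact: cl23 clv _ wv.
- move=> st2 [L2 [[inv2 gL2] st2_q qL2 cl2 clv]] _ _.
  have LN2 := good_list_size gL2.
  apply: run_assign.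
  + apply: eval_succ; first by apply: eval_regE; [exact: st2_q|apply: W_linear; lia].
    by apply: W_linear; lia.
  + by [].
  exists L2, q.+1; split=> //.
  + by rewrite /= /upd /= addnS.
  move=> q'; rewrite ltnS leq_eqVlt => /orP[/eqP->//|]; exact: cl2.
by rewrite subn0 /=; lia.
Qed.

(** Induction on the cardinality: [accessibleD1] gives a listed [X :\ v], and closure at its index
    puts [X] into the list. *)
Lemma closed_list_AccMet L :
  good_list L -> (forall q, q < size L -> closed_at L q n) -> L =i AccMet e.
Proof.
case=> _ sL L0 cl X; apply/idP/idP; first exact: sL.
rewrite inE; move: {2}#|X| (leqnn #|X|) => k.
elim: k X => [|k IHk] X.
  by rewrite leqn0 cards_eq0 => /eqP->.
have [->|X0] := eqVneq X set0; first by [].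
move=> Xk accX; have [v vX accY] := accessibleD1 accX X0.
have YL : X :\ v \in L.
  by apply: IHk accY; have := cardsD1 v X; rewrite vX; lia.
have := cl _ _ v (rank_lt v); rewrite -index_mem in YL.
move/(_ _ YL); rewrite nth_index -?index_mem // setD1K //.
by apply; exact: accessible_metric.
Qed.

(** * Output *)

Definition print_time := N * (n * 28 + 16) + 6.

Lemma run_print_list st L : list_inv st L -> size L <= N ->
  run W print_prog st print_time (fun st' => output st' = write_sets L).
Proof.
move=> inv0 LN; have [[st_n st_nn st_c] _ _ rows out] := inv0.
have nW : n < W by apply: W_linear; lia.
have W0 : 0 < W by exact: ltnW.
have cW : n + n + size L < W by apply: W_linear; lia.
pose base st1 := regs st1 rn = n /\ memory st1 = memory st.
pose I i st1 := base st1 /\ output st1 = write_sets (take (i - (n + n)) L).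
apply: (@run_for _ W_gt1 _ _ _ _ _ (n + n) (n + n + size L) (n * 28 + 6 + 2) I) => //.
- by apply: eval_regE => //; apply: W_linear; lia.
- by rewrite leq_addr.
- by split=> //; rewrite subnn take0.
- move=> i st1 /andP[le_i lt_i] st1_q st1_c [[st1_n st1_m] out1].
  have qL : i - (n + n) < size L by rewrite ltn_subLR.
  set q := i - (n + n) in qL out1.
  have iE : i = n + n + q by rewrite subnKC.
  apply: run_seq.
  pose J j st2 := [/\ base st2, regs st2 rq = i /\ regs st2 rc = n + n + size L
    & output st2 = write_sets (take q L) ++
        [seq (rank v).+1 | v <- take j (enum V) & v \in nth set0 L q]].
  apply: (@run_for _ W_gt1 _ _ _ _ _ 0 n 20 J) => //.
  + exact: eval_const.
  + by split=> //; rewrite take0 /= cats0.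
  + move=> j st2 /rank_surj[v ->] st2_v st2_n [[_ st2_m] [st2_q st2_c] out2].
    have iW : i < W by exact: ltn_trans cW.
    have ltv : rank v < size (enum V) by rewrite -cardE; exact: rank_lt.
    have takeS : take (rank v).+1 (enum V) = rcons (take (rank v) (enum V)) v.
      by rewrite (take_nth v) // nth_enum_rank.
    apply: (run_time (T := (8 + 10).+1)) => //.
    apply: run_if.
    * apply: (eval_set (r := i) (X := nth set0 L q) (v := v)) => //.
      - by rewrite iE st2_m; exact: rows.
      - exact: eval_regE.
      - by apply: leq_trans (ltnW lt_i) _; rewrite leq_add2l.
      exact: eval_rank.
    * move=> vX; apply: run_print.
      - apply: eval_succ; first exact: eval_rank st2_v.
        by apply: W_linear; have := rank_lt v; lia.
      - by [].
      split=> //; split=> //=; rewrite takeS filter_rcons.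
      by case: (v \in _) vX => // _; rewrite map_rcons -rcons_cat out2.
    * move=> vX; apply: run_skip => //.
      split=> //; split=> //=; rewrite takeS filter_rcons.
      by case: (v \in _) vX => // _; rewrite out2.
  + move=> st2 [[_ st2_m] [st2_q st2_c] out2] _ st2_n.
    apply: run_print; first exact: eval_const.
      by [].
    split=> //; split=> //=.
    rewrite subSn // -/q (take_nth set0) // /write_sets map_rcons flatten_rcons.
    rewrite -/(write_sets _) /write_set -rcons_cat out2; congr rcons; congr (_ ++ _).
    (* A set is enumerated in the order of [enum V], the order in which the loop visits the
       columns. *)
    have -> : enum (nth set0 L q) = [seq v <- enum V | v \in nth set0 L q].
      by rewrite enumT.
    by rewrite take_oversize -?cardE.
  by rewrite subn0 /=; lia.
- by move=> st1 [_ ->] _ _; rewrite addKn take_size.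
have : size L * (n * 28 + 6 + 2 + 8) <= N * (n * 28 + 16) by apply: leq_mul => //; lia.
by rewrite addKn /print_time /=; lia.
Qed.

(** * The complete program and its cost *)

Definition total_time :=
  7 + (n * 20 + 6 + (dist_time + (search_time + print_time))).

Lemma run_enum_prog : run W enum_prog (init_state e) total_time
  (fun st => exists L, [/\ uniq L, L =i AccMet e & output st = write_sets L]).
Proof.
have nW : n < W by apply: W_linear; lia.
have W0 : 0 < W by exact: ltnW.
have size_in : size [seq (e u v : nat) | u <- enum V, v <- enum V] = n * n.
  by rewrite size_allpairs -cardE.
apply: run_seq; apply: (run_time (T := 3 + 4)); first by [].
apply: run_seq; apply: run_assign.
- by apply: (@eval_mem _ _ _ 0); [exact: eval_const|].
- by [].
apply: run_assign.
- apply: (@eval_op _ _ OpAdd); [by apply: eval_regE|by apply: eval_regE|].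
  by apply: W_linear; rewrite /= /upd /= -/n; lia.
- by [].
apply: run_seq; apply: run_weaken (run_diag _) _ _ => //.
  split=> //.
  - move=> u v; rewrite /cell /=.
    have [ltu ltv] := (rank_lt u, rank_lt v).
    rewrite [n]cardE (nth_allpairs _ u v) -?cardE //.
    by rewrite !nth_enum_rank.
  (* Beyond the [n * n] matrix entries the memory reads the default 0: an empty distance table,
     followed by the empty set. *)
  - move=> u v; rewrite /cell /= nth_default // size_in.
    by have := leq_addr (rank u) n => /leq_mul/(_ (leqnn n)); lia.
  - move=> v; rewrite /cell /= nth_default ?inE // size_in; nia.
move=> st1 inv1; apply: run_seq; apply: run_weaken (run_dist inv1) _ _ => //.
move=> st2 inv2; apply: run_seq; apply: run_weaken (run_search inv2) _ _ => //.
move=> st3 [L [inv3 gL cl]].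
apply: run_weaken (run_print_list inv3 (good_list_size gL)) _ _ => //.
move=> st4 out; exists L; split=> //; first by case: gL.
exact: closed_list_AccMet.
Qed.

End Verification.

(** Without vertices the product in the time bound vanishes, so the cost per listed set must be
    bounded by a constant. *)
Lemma AccMet_empty_type (V : finType) (e : rel V) : #|V| = 0 -> #|AccMet e| <= 1.
Proof.
move=> V0; apply: leq_trans (max_card _) _.
have := card_powerset [set: V]; rewrite cardsT V0 expn0 => <-.
by apply: subset_leq_card; apply/subsetP=> X _; rewrite inE subsetT.
Qed.

Lemma total_time_bound (V : finType) (e : rel V) :
  total_time e <= 1000 * (#|AccMet e| ^ 2 * #|V| ^ 3 + 1).
Proof.
have := card_AccMet_gt e; have := @AccMet_empty_type V e.
rewrite /total_time /dist_time /dist_time2 /dist_time3 /search_time /extend_time.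
rewrite /print_time /= !expnS !expn0 !muln1.
move: #|V| #|AccMet e| => n N N1 nN.
case: (posnP n) => [n0|n0]; first by rewrite n0 in N1 *; have := N1 erefl; lia.
have N0 : 0 < N by lia.
set x := N * N * (n * (n * n)).
(* The expanded time is a sum of monomials in [N] and [n], each at most [x]; surplus factors [n] are
   put in the places of [N]. The digits in the names below are the exponents of [N] and [n]. *)
have le_x a b c d f : a <= N -> b <= N -> c <= n -> d <= n -> f <= n ->
    a * b * (c * (d * f)) <= x by move=> *; do !apply: leq_mul.
have e00 := le_x 1 1 1 1 1 N0 N0 n0 n0 n0.
have e01 := le_x 1 1 n 1 1 N0 N0 (leqnn n) n0 n0.
have e02 := le_x 1 1 n n 1 N0 N0 (leqnn n) (leqnn n) n0.
have e03 := le_x 1 1 n n n N0 N0 (leqnn n) (leqnn n) (leqnn n).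
have e04 := le_x n 1 n n n (ltnW nN) N0 (leqnn n) (leqnn n) (leqnn n).
have e10 := le_x N 1 1 1 1 (leqnn N) N0 n0 n0 n0.
have e11 := le_x N 1 n 1 1 (leqnn N) N0 (leqnn n) n0 n0.
have e12 := le_x N 1 n n 1 (leqnn N) N0 (leqnn n) (leqnn n) n0.
have e13 := le_x N 1 n n n (leqnn N) N0 (leqnn n) (leqnn n) (leqnn n).
have e14 := le_x N n n n n (leqnn N) (ltnW nN) (leqnn n) (leqnn n) (leqnn n).
have e21 := le_x N N n 1 1 (leqnn N) (leqnn N) (leqnn n) n0 n0.
have e22 := le_x N N n n 1 (leqnn N) (leqnn N) (leqnn n) (leqnn n) n0.
clear le_x N1 nN n0 N0.
clearbody x.
rewrite !(mulnDl, mulnDr, mul1n, muln1, mulnA)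
  in e00 e01 e02 e03 e04 e10 e11 e12 e13 e14 e21 e22 *.
by lia.
Qed.

(* Words have O(log (n + N)) bits. The "+ 1" in the time bound only matters
   for the graph without vertices. *)
Theorem theorem2 :
  exists (p : cmd) (c d : nat),
    forall (V : finType) (e : rel V),
      symmetric e -> irreflexive e ->
      let n := #|V| in
      let N := #|AccMet e| in
      exists (s : seq {set V}) (t : nat) (st : state),
        [/\ uniq s,
            s =i AccMet e,
            exec ((n + N + 2) ^ d) p (init_state e) t st,
            output st = write_sets s
          & t <= c * (N ^ 2 * n ^ 3 + 1)].
Proof.
exists enum_prog, 1000, 4 => V e _ _ n N.
(* As [N] is positive, the base is at least 3, and its square exceeds 4. *)
have W_large : 4 * (n + N + 2) ^ 2 < (n + N + 2) ^ 4.
  have K3 : 3 <= n + N + 2 by have := card_AccMet_gt e; rewrite -/N; lia.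
  move: (n + N + 2) K3 => K K3; rewrite (expnD _ 2 2) ltn_pmul2r.
    by apply: (@leq_trans (3 ^ 2)); rewrite ?leq_exp2r.
  by rewrite expn_gt0; apply/orP; left; apply: leq_trans K3.
have [t [st [ex tle [L [uL LA out]]]]] := run_enum_prog W_large.
by exists L, t, st; split=> //; exact: leq_trans tle (total_time_bound e).
Qed.
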